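(* Let $(X,x)$ and $(Y,y)$ be two pointed Hausdorff spaces. If $\mathrm{Sh}_{\mathrm{CH}}(X,x)=\mathrm{Sh}_{\mathrm{CH}}(Y,y)$, then the homotopy groups $\pi_n(X,x)$ and $\pi_n(Y,y)$ are isomorphic for every integer $n\ge 1$.
   Context: Maps are continuous. HCpt$_*$ is the category whose objects are pointed compact Hausdorff spaces and whose morphisms are (basepoint-preserving) homotopy classes $[\varphi]$ of pointed maps. Direct systems. A directed set is a preordered set in which any two elements have an upper bound. A direct system in a category $\mathscr C$ is $X^*=\{X_a,p_{aa'},A\}$ with $A$ a directed set, objects $X_a$ ($a\in A$), and morphisms $p_{aa'}:X_a\to X_{a'}$ for $a\le a'$, with $p_{aa}=1_{X_a}$ and $X_a\to X_{a'}\to X_{a''}$ composing to $p_{aa''}$ for $a\le a'\le a''$. A morphism $F=(f_a,f):X^*\to Y^*=\{Y_b,q_{bb'},B\}$ consists of an order-preserving function $f:A\to B$ and morphisms $f_a:X_a\to Y_{f(a)}$ with $q_{f(a)f(a')}\circ f_a=f_{a'}\circ p_{aa'}$ for $a\le a'$. Composition is $(g_b,g)\circ(f_a,f)=(g_{f(a)}\circ f_a,\,g\circ f)$, and $1_{X^*}=(1_{X_a},1_A)$. Two morphisms $(f_a,f),(g_a,g):X^*\to Y^*$ are equivalent, written $\simeq$, if for each $a\in A$ there is $b\in B$ with $f(a)\le b$, $g(a)\le b$ and $q_{f(a)b}\circ f_a=q_{g(a)b}\circ g_a$. Pointed CH-shape. For a pointed Hausdorff space $(X,x)$ let $c(X,x)$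 be the set of all pointed compact subsets $(K,x)$, $x\in K\subset X$, ordered by inclusion, and let $C(X,x)=\{(K,x),[i_{KK'}],c(X,x)\}$ be the direct system in HCpt$_*$ with $i_{KK'}:(K,x)\to(K',x)$ the inclusion for $K\subset K'$. $\mathrm{Sh}_{\mathrm{CH}}(X,x)=\mathrm{Sh}_{\mathrm{CH}}(Y,y)$ means there are morphisms of direct systems in HCpt$_*$ $F:C(X,x)\to C(Y,y)$ and $G:C(Y,y)\to C(X,x)$ with $GF\simeq 1_{C(X,x)}$ and $FG\simeq 1_{C(Y,y)}$. *)

(* Defs.v *)
From HB Require Import structures.
From mathcomp Require Import all_boot all_order all_algebra.
From mathcomp Require Import generic_quotient.
From mathcomp Require Import all_classical all_reals topology normedtype.
From mathcomp Require Import lra.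

Set Implicit Arguments.
Unset Strict Implicit.
Unset Printing Implicit Defensive.

Import Order.TTheory GRing.Theory Num.Theory.
Import numFieldNormedType.Exports.

Local Open Scope classical_set_scope.
Local Open Scope ring_scope.
Local Open Scope quotient_scope.

Notation unitI R := (set_type (`[0%R, 1%R]%classic : set R)).

Section unit_interval.
Context {R : realType}.

Lemma clamp_subproof (r : R) : Num.max 0 (Num.min 1 r) \in `[0, 1]%classic.
Proof.
by rewrite inE /= in_itv/= le_max lexx /= ge_max ler01 ge_min lexx.
Qed.

(* Retraction of R onto [0, 1]; it lets paths be reparametrized by formulas
   without carrying bounds, e.g. clamp (2 * s). *)
Definition clamp (r : R) : unitI R := Sub (Num.max 0 (Num.min 1 r)) (clamp_subproof r).

Lemma unit0_subproof : (0 : R) \in `[0, 1]%classic.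
Proof. by rewrite inE /= in_itv/= lexx ler01. Qed.

Lemma unit1_subproof : (1 : R) \in `[0, 1]%classic.
Proof. by rewrite inE /= in_itv/= lexx ler01. Qed.

Definition unit0 : unitI R := Sub 0 unit0_subproof.
Definition unit1 : unitI R := Sub 1 unit1_subproof.

Lemma unitI_ge0 (s : unitI R) : 0 <= val s.
Proof. by case: s => s /= /set_mem /=; rewrite in_itv/= => /andP[]. Qed.

Lemma unitI_le1 (s : unitI R) : val s <= 1.
Proof. by case: s => s /= /set_mem /=; rewrite in_itv/= => /andP[]. Qed.

Lemma clampE (r : R) : 0 <= r <= 1 -> val (clamp r) = r.
Proof. by move=> /andP[r0 r1] /=; rewrite (min_idPr r1) (max_idPr r0). Qed.

Lemma clampK (s : unitI R) : clamp (val s) = s.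
Proof. by apply: val_inj; rewrite clampE// unitI_ge0 unitI_le1. Qed.

Lemma clamp_le0 (r : R) : r <= 0 -> clamp r = unit0.
Proof.
move=> r0; apply: val_inj => /=; apply/max_idPl.
by rewrite ge_min r0 orbT.
Qed.

Lemma clamp_ge1 (r : R) : 1 <= r -> clamp r = unit1.
Proof.
by move=> r1; apply: val_inj => /=; rewrite (min_idPl r1) (max_idPr ler01).
Qed.

Lemma val_continuous : continuous (val : unitI R -> R).
Proof. exact: initial_continuous. Qed.

Lemma clamp_continuous : continuous clamp.
Proof.
apply: continuous_comp_initial => r.
apply: (@continuous_max R R (cst 0) (fun r => Num.min 1 r)).
  exact: cvg_cst.
apply: (@continuous_min R R (cst 1) id); first exact: cvg_cst.
exact: cvg_id.
Qed.

Lemma paste_continuous (T U : topologicalType) (c : T -> R) (a : R)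
    (f g : T -> U) : continuous c -> continuous f -> continuous g ->
  (forall t, c t = a -> f t = g t) ->
  continuous (fun t => if c t <= a then f t else g t).
Proof.
move=> cc cf cg fg; apply/continuous_subspace_setT.
have -> : [set: T] = (c @^-1` [set r | r <= a]) `|` (c @^-1` [set r | a <= r]).
  by apply/esym; rewrite -subTset => t _ /=; apply/orP; exact: le_total.
apply: withinU_continuous.
- by apply: preimage_closed => //; exact: closed_le.
- by apply: preimage_closed => //; exact: closed_ge.
- apply: (@subspace_eq_continuous _ _ _ f); last exact: continuous_subspaceT.
  by move=> t /set_mem /= cta; rewrite /from_subspace/= cta.
- apply: (@subspace_eq_continuous _ _ _ g); last exact: continuous_subspaceT.
  move=> t /set_mem /= act; rewrite /from_subspace/=; case: ifPn => // cta.
  by apply/esym/fg/le_anti; rewrite act andbT.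
Qed.

End unit_interval.

Lemma pair_cts (S T U : topologicalType) (f : S -> T) (g : S -> U) :
  continuous f -> continuous g -> continuous (fun z => (f z, g z)).
Proof. by move=> cf cg z; apply: cvg_pair; [exact: cf|exact: cg]. Qed.

Lemma comp_cts (S T U : topologicalType) (g : T -> U) (f : S -> T) :
  continuous g -> continuous f -> continuous (fun z => g (f z)).
Proof. by move=> cg cf z; apply: continuous_comp; [exact: cf|exact: cg]. Qed.

Arguments comp_cts {S T U g f}.

Lemma fst_cts (T U : topologicalType) : continuous (@fst T U).
Proof. by move=> z; exact: cvg_fst. Qed.

Lemma snd_cts (T U : topologicalType) : continuous (@snd T U).
Proof. by move=> z; exact: cvg_snd. Qed.

(* Maps of pairs (T, A) -> (U, {u}). With A a base point these are the pointed
   maps; with A the boundary of a cube they represent homotopy group elements. *)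
Record relmap (T U : topologicalType) (A : set T) (u : U) := Relmap {
  relmap_fun :> T -> U;
  relmap_continuous : continuous relmap_fun;
  relmap_sub : forall t, A t -> relmap_fun t = u }.

Arguments relmap_continuous {T U A u} r.
Arguments relmap_sub {T U A u} r t.

Lemma relmap_eq (T U : topologicalType) (A : set T) (u : U)
  (f g : relmap A u) : f =1 g -> f = g.
Proof.
case: f g => [f fc fA] [g gc gA] /= /funext fg; subst g.
by congr Relmap; exact: Prop_irrelevance.
Qed.

HB.instance Definition _ (T U : topologicalType) (A : set T) (u : U) :=
  gen_eqMixin (relmap A u).
HB.instance Definition _ (T U : topologicalType) (A : set T) (u : U) :=
  gen_choiceMixin (relmap A u).

(* Homotopy through maps of pairs. *)
Definition homotopic (R : realType) (T U : topologicalType) (A : set T) (u : U)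
    (f g : relmap A u) : Prop :=
  exists H : T * unitI R -> U,
    [/\ continuous H,
        forall t, H (t, unit0) = f t,
        forall t, H (t, unit1) = g t &
        forall t s, A t -> H (t, s) = u].

Section homotopy_classes.
Context (R : realType) (T U : topologicalType) (A : set T) (u : U).
Implicit Types f g h : relmap A u.

Lemma homotopic_refl f : homotopic R f f.
Proof.
exists (fun z => f z.1); split=> //.
- by apply: comp_cts; [exact: relmap_continuous|exact: fst_cts].
- by move=> t s At /=; exact: relmap_sub.
Qed.

Lemma homotopic_sym f g : homotopic R f g -> homotopic R g f.
Proof.
move=> [H [cH H0 H1 HA]].
exists (fun z => H (z.1, clamp (1 - val z.2))); split=> /=.
- apply: comp_cts; first exact: cH.
  apply: pair_cts; first exact: fst_cts.
  apply: comp_cts; first exact: clamp_continuous.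
  move=> z; apply: cvgB; first exact: cvg_cst.
  by apply: (comp_cts val_continuous); exact: snd_cts.
- by move=> t; rewrite clamp_ge1 ?subr0.
- by move=> t; rewrite clamp_le0 ?subrr.
- by move=> t s; exact: HA.
Qed.

Lemma homotopic_trans f g h :
  homotopic R f g -> homotopic R g h -> homotopic R f h.
Proof.
move=> [H [cH H0 H1 HA]] [H' [cH' H'0 H'1 H'A]].
pose K (z : T * unitI R) := if val z.2 <= 2^-1 then H (z.1, clamp (2 * val z.2))
  else H' (z.1, clamp (2 * val z.2 - 1)).
have cs : continuous (fun z : T * unitI R => val z.2).
  by apply: (comp_cts val_continuous); exact: snd_cts.
exists K; split.
- apply: (@paste_continuous R _ _ (fun z : T * unitI R => val z.2)) => //.
  + apply: comp_cts; first exact: cH.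
    apply: pair_cts; first exact: fst_cts.
    apply: comp_cts; first exact: clamp_continuous.
    by move=> z; apply: cvgM; [exact: cvg_cst|exact: cs].
  + apply: comp_cts; first exact: cH'.
    apply: pair_cts; first exact: fst_cts.
    apply: comp_cts; first exact: clamp_continuous.
    move=> z; apply: cvgB; last exact: cvg_cst.
    by apply: cvgM; [exact: cvg_cst|exact: cs].
  + move=> z ->; rewrite clamp_ge1 ?clamp_le0 ?H1 ?H'0//; lra.
- by move=> t; rewrite /K/= clamp_le0 ?H0 ?ifT//; lra.
- by move=> t; rewrite /K/= ifF ?clamp_ge1 ?H'1//; [lra|apply/negbTE; lra].
- by move=> t s At; rewrite /K/=; case: ifP => _; [exact: HA|exact: H'A].
Qed.

Definition homotopicb f g := `[< homotopic R f g >].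

Lemma homotopicb_refl : reflexive homotopicb.
Proof. by move=> f; apply/asboolP; exact: homotopic_refl. Qed.

Lemma homotopicb_sym : symmetric homotopicb.
Proof. by move=> f g; apply/asboolP/asboolP; exact: homotopic_sym. Qed.

Lemma homotopicb_trans : transitive homotopicb.
Proof.
move=> g f h /asboolP fg /asboolP gh; apply/asboolP.
exact: homotopic_trans fg gh.
Qed.

Canonical homotopic_equiv :=
  EquivRel homotopicb homotopicb_refl homotopicb_sym homotopicb_trans.

Definition htpy_class := {eq_quot homotopic_equiv}.

HB.instance Definition _ := Choice.on htpy_class.
HB.instance Definition _ := Quotient.on htpy_class.

Definition hclass f : htpy_class := \pi f.

Lemma hclass_eqP f g : hclass f = hclass g <-> homotopic R f g.
Proof. by split=> [/eqmodP/asboolP//|fg]; apply/eqmodP/asboolP. Qed.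

Lemma homotopic_repr f : homotopic R (repr (hclass f)) f.
Proof. by apply/hclass_eqP; rewrite /hclass reprK. Qed.

Lemma hclassW (P : htpy_class -> Prop) :
  (forall f, P (hclass f)) -> forall c, P c.
Proof. by move=> Pf; apply: quotW. Qed.

End homotopy_classes.

Definition cube (R : realType) (n : nat) : topologicalType :=
  prod_topology (fun _ : 'I_n => unitI R).

Definition cube_boundary (R : realType) (n : nat) : set (cube R n) :=
  [set t : cube R n | exists i, t i = unit0 \/ t i = unit1].

Definition homotopy_group (R : realType) (n : nat) (X : topologicalType)
  (x : X) := htpy_class R (@cube_boundary R n) x.

Section loops.
Context (R : realType) (n : nat) (X : topologicalType) (x : X).
Local Notation cube := (cube R n.+1).
Local Notation loop := (relmap (@cube_boundary R n.+1) x).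
Implicit Types (t : cube) (s : unitI R) (f g h : loop).

Definition set_coord0 t s : cube := fun i => if i == ord0 then s else t i.

Lemma set_coord0_same t s : set_coord0 t s ord0 = s.
Proof. by rewrite /set_coord0 eqxx. Qed.

Lemma set_coord0_id t : set_coord0 t (t ord0) = t.
Proof. by apply/funext => i; rewrite /set_coord0; case: eqP => [->|]. Qed.

Lemma set_coord0_set t s s' : set_coord0 (set_coord0 t s) s' = set_coord0 t s'.
Proof. by apply/funext => i; rewrite /set_coord0; case: eqP. Qed.

Lemma coord_cts i : continuous (fun t : cube => t i).
Proof. exact: (@proj_continuous _ (fun _ : 'I_n.+1 => unitI R) i). Qed.

Lemma set_coord0_cts (T : topologicalType) (c : T -> cube) (s : T -> unitI R) :
  continuous c -> continuous s -> continuous (fun z => set_coord0 (c z) (s z)).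
Proof.
move=> cc cs z; apply/cvg_sup => i.
have: continuous (fun z => set_coord0 (c z) (s z) i).
  by rewrite /set_coord0; case: eqP => // _; exact: (comp_cts (@coord_cts i) cc).
move=> ci.
exact: (@continuous_comp_initial _ _ _ (fun t : cube => t i)
  (fun z => set_coord0 (c z) (s z)) ci z).
Qed.

Lemma boundary_set_coord0 t s :
  s = unit0 \/ s = unit1 -> cube_boundary (set_coord0 t s).
Proof. by move=> s01; exists ord0; rewrite set_coord0_same. Qed.

Lemma boundary_set_coordP t s : cube_boundary t ->
  (val (t ord0) = 0 -> s = unit0 \/ s = unit1) ->
  (val (t ord0) = 1 -> s = unit0 \/ s = unit1) ->
  cube_boundary (set_coord0 t s).
Proof.
move=> [i ti] s0 s1; have [i0|i0] := eqVneq i ord0; last first.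
  by exists i; rewrite /set_coord0 (negbTE i0).
apply: boundary_set_coord0; move: ti; rewrite i0.
by case=> ti; [apply: s0|apply: s1]; rewrite ti.
Qed.

(* Concatenation along the first coordinate of the cube; the argument of clamp
   is already in [0, 1] on each branch. *)
Definition concat_fun f g t : X :=
  if val (t ord0) <= 2^-1 then f (set_coord0 t (clamp (2 * val (t ord0))))
  else g (set_coord0 t (clamp (2 * val (t ord0) - 1))).

Lemma val0_cts : continuous (fun t => val (t ord0)).
Proof. exact: (comp_cts val_continuous (@coord_cts ord0)). Qed.

Lemma scale_cts (T : topologicalType) (a : R) (c : T -> R) :
  continuous c -> continuous (fun z => a * c z).
Proof. by move=> cc z; apply: cvgM; [exact: cvg_cst|exact: cc]. Qed.

Lemma shift_cts (T : topologicalType) (a : R) (c : T -> R) :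
  continuous c -> continuous (fun z => c z + a).
Proof. by move=> cc z; apply: cvgD; [exact: cc|exact: cvg_cst]. Qed.

Lemma concat_continuous f g : continuous (concat_fun f g).
Proof.
apply: (paste_continuous val0_cts).
- apply: (comp_cts (relmap_continuous f)); apply: set_coord0_cts.
    by move=> t; exact: cvg_id.
  by apply: (comp_cts clamp_continuous); apply: scale_cts; exact: val0_cts.
- apply: (comp_cts (relmap_continuous g)); apply: set_coord0_cts.
    by move=> t; exact: cvg_id.
  apply: (comp_cts clamp_continuous); apply: shift_cts; apply: scale_cts.
  exact: val0_cts.
- move=> t t0; rewrite !relmap_sub//; apply: boundary_set_coord0.
    by left; rewrite t0 clamp_le0//; lra.
  by right; rewrite t0 clamp_ge1//; lra.
Qed.

Lemma concat_sub f g t : cube_boundary t -> concat_fun f g t = x.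
Proof.
move=> bt; rewrite /concat_fun; case: ifP => t0; apply: relmap_sub;
  apply: boundary_set_coordP => // t0E.
- by left; rewrite t0E clamp_le0//; lra.
- by right; rewrite t0E clamp_ge1//; lra.
- by left; rewrite t0E clamp_le0//; lra.
- by right; rewrite t0E clamp_ge1//; lra.
Qed.

Definition concat f g : loop :=
  Relmap (@concat_continuous f g) (@concat_sub f g).

Lemma concatE f g t : concat f g t = concat_fun f g t. Proof. by []. Qed.

Definition const_loop : loop :=
  Relmap (fun _ => cvg_cst x) (fun (t : cube) _ => erefl x).

(* Reparametrization of the first coordinate; warp_homotopic yields the group
   axioms up to homotopy. *)
Definition warp_fun f (p : R -> R) t : X :=
  f (set_coord0 t (clamp (p (val (t ord0))))).

Lemma warp_continuous f p : continuous p -> continuous (warp_fun f p).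
Proof.
move=> cp; apply: (comp_cts (relmap_continuous f)); apply: set_coord0_cts.
  by move=> t; exact: cvg_id.
exact: comp_cts clamp_continuous (comp_cts cp val0_cts).
Qed.

Definition endpoints (p : R -> R) :=
  (p 0 = 0 \/ p 0 = 1) /\ (p 1 = 0 \/ p 1 = 1).

Lemma clamp0 : clamp (0 : R) = unit0. Proof. exact: clamp_le0. Qed.
Lemma clamp1 : clamp (1 : R) = unit1. Proof. exact: clamp_ge1. Qed.

Lemma warp_boundary p t : endpoints p -> cube_boundary t ->
  cube_boundary (set_coord0 t (clamp (p (val (t ord0))))).
Proof.
move=> [p0 p1] bt; apply: boundary_set_coordP => // ->.
  by case: p0 => ->; [left; exact: clamp0|right; exact: clamp1].
by case: p1 => ->; [left; exact: clamp0|right; exact: clamp1].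
Qed.

Lemma warp_sub f p : endpoints p ->
  forall t, cube_boundary t -> warp_fun f p t = x.
Proof. by move=> ep t bt; apply: relmap_sub; exact: warp_boundary. Qed.

Definition warp f p (cp : continuous p) (ep : endpoints p) : loop :=
  Relmap (@warp_continuous f p cp) (@warp_sub f p ep).

Lemma warp_homotopic f p q (cp : continuous p) (cq : continuous q)
    (ep : endpoints p) (eq : endpoints q) : p 0 = q 0 -> p 1 = q 1 ->
  homotopic R (warp f cp ep) (warp f cq eq).
Proof.
move=> pq0 pq1.
have c1 : continuous (fun z : cube * unitI R => val (z.1 ord0)).
  exact: comp_cts val0_cts (@fst_cts _ _).
have c2 : continuous (fun z : cube * unitI R => val z.2).
  exact: comp_cts val_continuous (@snd_cts _ _).
exists (fun z => f (set_coord0 z.1 (clamp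
  ((1 - val z.2) * p (val (z.1 ord0)) + val z.2 * q (val (z.1 ord0)))))); split.
- apply: (comp_cts (relmap_continuous f)).
  apply: set_coord0_cts; first exact: fst_cts.
  apply: (comp_cts clamp_continuous) => z; apply: cvgD; apply: cvgM.
  + by apply: cvgB; [exact: cvg_cst|exact: c2].
  + exact: (comp_cts cp c1).
  + exact: c2.
  + exact: (comp_cts cq c1).
- by move=> t /=; rewrite subr0 mul1r mul0r addr0.
- by move=> t /=; rewrite subrr mul1r mul0r add0r.
- move=> t s bt /=; apply: relmap_sub.
  set r := fun v => (1 - val s) * p v + val s * q v.
  apply: (@warp_boundary r) => //; rewrite /endpoints/r -pq0 -pq1.
  by rewrite -!mulrDl subrK !mul1r.
Qed.

Lemma loop_warp f h (p q : R -> R) : continuous p -> continuous q ->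
  endpoints p -> p 0 = q 0 -> p 1 = q 1 ->
  f =1 warp_fun h p -> forall g, g =1 warp_fun h q -> homotopic R f g.
Proof.
move=> cp cq ep pq0 pq1 fE g gE.
have eq : endpoints q by rewrite /endpoints -pq0 -pq1.
rewrite (@relmap_eq _ _ _ _ f (warp h cp ep))//.
by rewrite (@relmap_eq _ _ _ _ g (warp h cq eq))//; exact: warp_homotopic.
Qed.

Lemma warp_id f : f =1 warp_fun f id.
Proof. by move=> t; rewrite /warp_fun clampK set_coord0_id. Qed.

Lemma val0_ge0 t : 0 <= val (t ord0). Proof. exact: unitI_ge0. Qed.
Lemma val0_le1 t : val (t ord0) <= 1. Proof. exact: unitI_le1. Qed.

Lemma id_cts : continuous (id : R -> R).
Proof. by move=> r; exact: cvg_id. Qed.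

Lemma affine_cts (a b : R) : continuous (fun r : R => a * r + b).
Proof. by apply: shift_cts; apply: scale_cts; exact: id_cts. Qed.

Lemma min_cts (p q : R -> R) : continuous p -> continuous q ->
  continuous (fun r => Num.min (p r) (q r)).
Proof. by move=> cp cq r; apply: continuous_min; [exact: cp|exact: cq]. Qed.

Lemma max_cts (p q : R -> R) : continuous p -> continuous q ->
  continuous (fun r => Num.max (p r) (q r)).
Proof. by move=> cp cq r; apply: continuous_max; [exact: cp|exact: cq]. Qed.

Lemma concat_const f : homotopic R (concat f const_loop) f.
Proof.
apply: (@loop_warp _ f (fun r => Num.min (2 * r + 0) (0 * r + 1)) id) => //.
- by apply: min_cts; exact: affine_cts.
- exact: id_cts.
- by rewrite /endpoints; split; [left|right]; case: (leP (2 * _ + 0)) => ?; lra.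
- by case: (leP (2 * _ + 0)) => ?; lra.
- by case: (leP (2 * _ + 0)) => ?; lra.
- move=> t; rewrite concatE /concat_fun /warp_fun; have := val0_le1 t.
  set v := val _ => v1; case: ifPn => t0.
    by congr (f (set_coord0 _ (clamp _))); case: (leP (2 * v + 0)) => ?; lra.
  rewrite [RHS]relmap_sub//; apply: boundary_set_coord0; right.
  by apply: clamp_ge1; case: (leP (2 * v + 0)) => ?; lra.
- exact: warp_id.
Qed.

Lemma const_concat f : homotopic R (concat const_loop f) f.
Proof.
apply: (@loop_warp _ f (fun r => Num.max (2 * r + -1) (0 * r + 0)) id) => //.
- by apply: max_cts; exact: affine_cts.
- exact: id_cts.
- by rewrite /endpoints; split; [left|right]; case: (leP (2 * _ + -1)) => ?; lra.
- by case: (leP (2 * _ + -1)) => ?; lra.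
- by case: (leP (2 * _ + -1)) => ?; lra.
- move=> t; rewrite concatE /concat_fun /warp_fun; have := val0_ge0 t.
  set v := val _ => v0; case: ifPn => t0; last first.
    by congr (f (set_coord0 _ (clamp _))); case: (leP (2 * v + -1)) => ?; lra.
  rewrite [RHS]relmap_sub//; apply: boundary_set_coord0; left.
  by apply: clamp_le0; case: (leP (2 * v + -1)) => ?; lra.
- exact: warp_id.
Qed.

Definition inverse_fun f t : X :=
  f (set_coord0 t (clamp (1 - val (t ord0)))).

Lemma inverse_continuous f : continuous (inverse_fun f).
Proof.
apply: (@warp_continuous f (fun r => 1 - r)) => r.
by apply: cvgB; [exact: cvg_cst|exact: cvg_id].
Qed.

Lemma inverse_sub f t : cube_boundary t -> inverse_fun f t = x.
Proof.
apply: (@warp_sub f (fun r => 1 - r)); rewrite /endpoints.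
by rewrite subr0 subrr; split; [right|left].
Qed.

Definition inverse f : loop := Relmap (@inverse_continuous f) (@inverse_sub f).

Lemma inverseE f t : inverse f t = inverse_fun f t. Proof. by []. Qed.

Lemma concat_inverse f : homotopic R (concat f (inverse f)) const_loop.
Proof.
apply: (@loop_warp _ f (fun r => Num.min (2 * r + 0) (- 2 * r + 2))
  (fun r => 0 * r + 0)) => //.
- by apply: min_cts; exact: affine_cts.
- exact: affine_cts.
- by rewrite /endpoints; split; left; case: (leP (2 * _ + 0)) => ?; lra.
- by case: (leP (2 * _ + 0)) => ?; lra.
- by case: (leP (2 * _ + 0)) => ?; lra.
- move=> t; rewrite concatE /concat_fun /warp_fun inverseE /inverse_fun.
  rewrite set_coord0_set.
  rewrite set_coord0_same; have := val0_ge0 t; have := val0_le1 t.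
  set v := \val (t ord0) => v1 v0; case: ifPn => t0.
    by congr (f (set_coord0 _ (clamp _))); case: (leP (2 * v + 0)) => ?; lra.
  congr (f (set_coord0 _ (clamp _))); rewrite clampE; last by lra.
  by case: (leP (2 * v + 0)) => ?; lra.
- move=> t; rewrite /warp_fun [RHS]relmap_sub//; apply: boundary_set_coord0; left.
  by apply: clamp_le0; lra.
Qed.

Lemma inverse_concat f : homotopic R (concat (inverse f) f) const_loop.
Proof.
apply: (@loop_warp _ f (fun r => Num.max (- 2 * r + 1) (2 * r + -1))
  (fun r => 0 * r + 1)) => //.
- by apply: max_cts; exact: affine_cts.
- exact: affine_cts.
- by rewrite /endpoints; split; right; case: (leP (- 2 * _ + 1)) => ?; lra.
- by case: (leP (- 2 * _ + 1)) => ?; lra.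
- by case: (leP (- 2 * _ + 1)) => ?; lra.
- move=> t; rewrite concatE /concat_fun /warp_fun inverseE /inverse_fun.
  rewrite set_coord0_set.
  rewrite set_coord0_same; have := val0_ge0 t; have := val0_le1 t.
  set v := \val (t ord0) => v1 v0; case: ifPn => t0; last first.
    by congr (f (set_coord0 _ (clamp _))); case: (leP (- 2 * v + 1)) => ?; lra.
  congr (f (set_coord0 _ (clamp _))); rewrite clampE; last by lra.
  by case: (leP (- 2 * v + 1)) => ?; lra.
- move=> t; rewrite /warp_fun [RHS]relmap_sub//; apply: boundary_set_coord0; right.
  by apply: clamp_ge1; lra.
Qed.

Lemma concatA f g h :
  homotopic R (concat f (concat g h)) (concat (concat f g) h).
Proof.
apply: homotopic_sym.
apply: (@loop_warp _ (concat f (concat g h)) (fun r => Num.min (2 * r + 0)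
  (Num.min (1 * r + 4^-1) (2^-1 * r + 2^-1))) id) => //.
- by apply: min_cts; [|apply: min_cts]; exact: affine_cts.
- exact: id_cts.
- rewrite /endpoints; split; [left|right].
    by case: (leP (1 * _ + _)) => ?; case: (leP (2 * _ + 0)) => ?; lra.
  by case: (leP (1 * _ + _)) => ?; case: (leP (2 * _ + 0)) => ?; lra.
- by case: (leP (1 * _ + _)) => ?; case: (leP (2 * _ + 0)) => ?; lra.
- by case: (leP (1 * _ + _)) => ?; case: (leP (2 * _ + 0)) => ?; lra.
- move=> t; rewrite /warp_fun !concatE /concat_fun !concatE.
  have := val0_ge0 t; have := val0_le1 t.
  set v := \val (t ord0) => v1 v0.
  set m := Num.min _ _.
  have m01 : 0 <= m <= 1.
    by rewrite /m; case: (leP (1 * _ + _)) => ?; case: (leP (2 * _ + 0)) => ?; lra.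
  rewrite /concat_fun !set_coord0_set !set_coord0_same -/v.
  rewrite (clampE m01).
  case: ifPn => v2; last first.
    have mE : m = 2^-1 * v + 2^-1.
      by rewrite /m; case: (leP (1 * _ + _)) => ?; case: (leP (2 * _ + 0)) => ?; lra.
    rewrite ifF; last by apply/negbTE; lra.
    rewrite clampE; last by lra.
    rewrite ifF; last by apply/negbTE; lra.
    by congr (h (set_coord0 _ (clamp _))); lra.
  rewrite clampE; last by lra.
  case: ifPn => v4.
    have mE : m = 2 * v.
      by rewrite /m; case: (leP (1 * _ + _)) => ?; case: (leP (2 * _ + 0)) => ?; lra.
    rewrite ifT; last by lra.
    by congr (f (set_coord0 _ (clamp _))); lra.
  have mE : m = v + 4^-1.
    by rewrite /m; case: (leP (1 * _ + _)) => ?; case: (leP (2 * _ + 0)) => ?; lra.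
  rewrite ifF; last by apply/negbTE; lra.
  rewrite clampE; last by lra.
  rewrite ifT; last by lra.
  by congr (g (set_coord0 _ (clamp _))); lra.
- exact: warp_id.
Qed.

Lemma homotopic_concat f f' g g' : homotopic R f f' -> homotopic R g g' ->
  homotopic R (concat f g) (concat f' g').
Proof.
move=> [H [cH H0 H1 Hb]] [K [cK K0 K1 Kb]].
have c1 : continuous (fun z : cube * unitI R => val (z.1 ord0)).
  exact: comp_cts val0_cts (@fst_cts _ _).
exists (fun z : cube * unitI R => if val (z.1 ord0) <= 2^-1
  then H (set_coord0 z.1 (clamp (2 * val (z.1 ord0))), z.2)
  else K (set_coord0 z.1 (clamp (2 * val (z.1 ord0) - 1)), z.2)); split.
- apply: (paste_continuous c1).
  + apply: (comp_cts cH); apply: pair_cts; last exact: snd_cts.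
    apply: set_coord0_cts; first exact: fst_cts.
    by apply: (comp_cts clamp_continuous); exact: scale_cts.
  + apply: (comp_cts cK); apply: pair_cts; last exact: snd_cts.
    apply: set_coord0_cts; first exact: fst_cts.
    by apply: (comp_cts clamp_continuous); apply: shift_cts; exact: scale_cts.
  + move=> z z0; rewrite Hb ?Kb//; apply: boundary_set_coord0.
      by left; rewrite z0 clamp_le0//; lra.
    by right; rewrite z0 clamp_ge1//; lra.
- by move=> t /=; rewrite H0 K0.
- by move=> t /=; rewrite H1 K1.
- move=> t s bt /=; case: ifP => t0; [apply: Hb|apply: Kb];
    apply: boundary_set_coordP => // t0E.
  + by left; rewrite t0E clamp_le0//; lra.
  + by right; rewrite t0E clamp_ge1//; lra.
  + by left; rewrite t0E clamp_le0//; lra.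
  + by right; rewrite t0E clamp_ge1//; lra.
Qed.

Lemma homotopic_inverse f f' :
  homotopic R f f' -> homotopic R (inverse f) (inverse f').
Proof.
move=> [H [cH H0 H1 Hb]].
exists (fun z : cube * unitI R =>
  H (set_coord0 z.1 (clamp (1 - val (z.1 ord0))), z.2)); split=> /=.
- apply: (comp_cts cH); apply: pair_cts; last exact: snd_cts.
  apply: set_coord0_cts; first exact: fst_cts.
  apply: (comp_cts clamp_continuous) => z; apply: cvgB; first exact: cvg_cst.
  exact: (comp_cts val0_cts (@fst_cts _ _)).
- by move=> t; rewrite H0.
- by move=> t; rewrite H1.
- move=> t s bt; apply: Hb; apply: boundary_set_coordP => // ->.
  + by right; rewrite clamp_ge1//; lra.
  + by left; rewrite clamp_le0//; lra.
Qed.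

Local Notation pi := (homotopy_group R n.+1 x).

Definition hgroup_one : pi := hclass R const_loop.
Definition hgroup_mul (a b : pi) : pi := hclass R (concat (repr a) (repr b)).
Definition hgroup_inv (a : pi) : pi := hclass R (inverse (repr a)).

Lemma hgroup_mulE f g : hgroup_mul (hclass R f) (hclass R g) = hclass R (concat f g).
Proof. by apply/hclass_eqP; apply: homotopic_concat; exact: homotopic_repr. Qed.

Lemma hgroup_invE f : hgroup_inv (hclass R f) = hclass R (inverse f).
Proof. by apply/hclass_eqP; apply: homotopic_inverse; exact: homotopic_repr. Qed.

Lemma hgroup_mulA : associative hgroup_mul.
Proof.
elim/hclassW => f; elim/hclassW => g; elim/hclassW => h.
by rewrite !hgroup_mulE; apply/hclass_eqP; exact: concatA.
Qed.

Lemma hgroup_mul1g : left_id hgroup_one hgroup_mul.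
Proof.
by elim/hclassW => f; rewrite hgroup_mulE; apply/hclass_eqP; exact: const_concat.
Qed.

Lemma hgroup_mulg1 : right_id hgroup_one hgroup_mul.
Proof.
by elim/hclassW => f; rewrite hgroup_mulE; apply/hclass_eqP; exact: concat_const.
Qed.

Lemma hgroup_mulVg : left_inverse hgroup_one hgroup_inv hgroup_mul.
Proof.
elim/hclassW => f; rewrite hgroup_invE hgroup_mulE; apply/hclass_eqP.
exact: inverse_concat.
Qed.

Lemma hgroup_mulgV : right_inverse hgroup_one hgroup_inv hgroup_mul.
Proof.
elim/hclassW => f; rewrite hgroup_invE hgroup_mulE; apply/hclass_eqP.
exact: concat_inverse.
Qed.

HB.instance Definition _ := Choice.on (homotopy_group R n.+1 x).
HB.instance Definition _ := isGroup.Build (homotopy_group R n.+1 x)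
  hgroup_mulA hgroup_mul1g hgroup_mulg1 hgroup_mulVg hgroup_mulgV.

End loops.

Definition isomorphic_groups (G H : groupType) : Prop :=
  exists f : {multiplicative G -> H}, bijective f.

Section relmap_comp.
Context (R : realType) (S T U : topologicalType).
Context (A : set S) (B : set T) (b : T) (u : U) (Bb : B b).

Lemma relmap_comp_continuous (g : relmap B u) (f : relmap A b) :
  continuous (g \o f).
Proof.
exact: comp_cts (relmap_continuous g) (relmap_continuous f).
Qed.

Lemma relmap_comp_sub (g : relmap B u) (f : relmap A b) t :
  A t -> (g \o f) t = u.
Proof. by move=> /(relmap_sub f) /= ->; exact: relmap_sub. Qed.

Definition relmap_comp (g : relmap B u) (f : relmap A b) : relmap A u :=
  Relmap (@relmap_comp_continuous g f) (@relmap_comp_sub g f).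

Lemma homotopic_comp (g g' : relmap B u) (f f' : relmap A b) :
  homotopic R g g' -> homotopic R f f' ->
  homotopic R (relmap_comp g f) (relmap_comp g' f').
Proof.
move=> [K [cK K0 K1 KB]] [H [cH H0 H1 HA]].
exists (fun z => K (H z, z.2)); split=> /=.
- apply: comp_cts; first exact: cK.
  by apply: pair_cts; [exact: cH|exact: snd_cts].
- by move=> t; rewrite H0 K0.
- by move=> t; rewrite H1 K1.
- by move=> t s At; rewrite HA// KB.
Qed.

End relmap_comp.

Record category := Category {
  cat_ob :> Type;
  cat_hom : cat_ob -> cat_ob -> Type;
  cat_id : forall X, cat_hom X X;
  cat_comp : forall X Y Z, cat_hom Y Z -> cat_hom X Y -> cat_hom X Z;
  cat_compA : forall X Y Z W (h : cat_hom Z W) (g : cat_hom Y Z)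
    (f : cat_hom X Y), cat_comp h (cat_comp g f) = cat_comp (cat_comp h g) f;
  cat_comp1f : forall X Y (f : cat_hom X Y), cat_comp (cat_id Y) f = f;
  cat_compf1 : forall X Y (f : cat_hom X Y), cat_comp f (cat_id X) = f }.

Arguments cat_hom {c} X Y.
Arguments cat_id {c} X.
Arguments cat_comp {c X Y Z} g f.

Notation "g \;o f" := (cat_comp g f) (at level 50, left associativity).

(* The order is a mere preorder, and an empty index set is allowed. *)
Record dirsys (C : category) := Dirsys {
  dirsys_disp : Order.disp_t;
  dirsys_idx : preorderType dirsys_disp;
  dirsys_ub : forall a b : dirsys_idx, exists2 c, (a <= c)%O & (b <= c)%O;
  dirsys_ob :> dirsys_idx -> C;
  dirsys_map : forall a a' : dirsys_idx, (a <= a')%O ->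
    cat_hom (dirsys_ob a) (dirsys_ob a');
  dirsys_map_id : forall a (aa : (a <= a)%O), dirsys_map aa = cat_id _;
  dirsys_map_comp : forall a a' a'' (aa' : (a <= a')%O) (a'a'' : (a' <= a'')%O)
    (aa'' : (a <= a'')%O), dirsys_map a'a'' \;o dirsys_map aa' = dirsys_map aa'' }.

Record dirmor (C : category) (X Y : dirsys C) := Dirmor {
  dirmor_idx : dirsys_idx X -> dirsys_idx Y;
  dirmor_homo : forall a a' : dirsys_idx X,
    (a <= a')%O -> (dirmor_idx a <= dirmor_idx a')%O;
  dirmor_ob : forall a, cat_hom (X a) (Y (dirmor_idx a));
  dirmor_nat : forall (a a' : dirsys_idx X) (aa' : (a <= a')%O),
    dirsys_map (dirmor_homo aa') \;o dirmor_ob a =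
    dirmor_ob a' \;o dirsys_map aa' }.

Section dirmor_comp.
Context (C : category).

Lemma dirmor_id_nat (X : dirsys C) (a a' : dirsys_idx X) (aa' : (a <= a')%O) :
  dirsys_map aa' \;o cat_id (X a) = cat_id (X a') \;o dirsys_map aa'.
Proof. by rewrite cat_compf1 cat_comp1f. Qed.

Definition dirmor_id (X : dirsys C) : dirmor X X :=
  @Dirmor C X X id (fun a a' aa' => aa') (fun a => cat_id (X a))
    (@dirmor_id_nat X).

Context (X Y Z : dirsys C) (G : dirmor Y Z) (F : dirmor X Y).

Lemma dirmor_comp_nat (a a' : dirsys_idx X) (aa' : (a <= a')%O) :
  dirsys_map (dirmor_homo G (dirmor_homo F aa')) \;o
    (dirmor_ob G (dirmor_idx F a) \;o dirmor_ob F a) =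
  (dirmor_ob G (dirmor_idx F a') \;o dirmor_ob F a') \;o dirsys_map aa'.
Proof. by rewrite cat_compA dirmor_nat -!cat_compA dirmor_nat. Qed.

Definition dirmor_comp : dirmor X Z :=
  @Dirmor C X Z (dirmor_idx G \o dirmor_idx F)
    (fun a a' aa' => dirmor_homo G (dirmor_homo F aa'))
    (fun a => dirmor_ob G (dirmor_idx F a) \;o dirmor_ob F a)
    dirmor_comp_nat.

End dirmor_comp.

Definition dirmor_equiv (C : category) (X Y : dirsys C) (F G : dirmor X Y) :=
  forall a, exists b (fb : (dirmor_idx F a <= b)%O) (gb : (dirmor_idx G a <= b)%O),
    dirsys_map fb \;o dirmor_ob F a = dirsys_map gb \;o dirmor_ob G a.

Record pcpthaus := Pcpthaus {
  pcpthaus_sort :> topologicalType;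
  pcpthaus_base : pcpthaus_sort;
  pcpthaus_compact : compact [set: pcpthaus_sort];
  pcpthaus_hausdorff : hausdorff_space pcpthaus_sort }.

Section HCpt.
Context (R : realType).

Definition ptmap (K L : pcpthaus) :=
  relmap [set pcpthaus_base K] (pcpthaus_base L).

Definition HCpt_hom (K L : pcpthaus) :=
  htpy_class R [set pcpthaus_base K] (pcpthaus_base L).

Definition ptmap_id (K : pcpthaus) : ptmap K K :=
  @Relmap K K [set pcpthaus_base K] (pcpthaus_base K) id
    (fun _ => @cvg_id _ _) (fun t kt => kt).

Definition ptmap_comp (K L M : pcpthaus) (g : ptmap L M) (f : ptmap K L) :
  ptmap K M := relmap_comp (erefl : [set _] _) g f.

Definition HCpt_id (K : pcpthaus) : HCpt_hom K K := hclass R (ptmap_id K).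

Definition HCpt_comp (K L M : pcpthaus) (g : HCpt_hom L M) (f : HCpt_hom K L) :
  HCpt_hom K M := hclass R (ptmap_comp (repr g) (repr f)).

Lemma HCpt_compE (K L M : pcpthaus) (g : ptmap L M) (f : ptmap K L) :
  HCpt_comp (hclass R g) (hclass R f) = hclass R (ptmap_comp g f).
Proof.
by apply/hclass_eqP/homotopic_comp; exact: homotopic_repr.
Qed.

Lemma HCpt_compA (K L M N : pcpthaus) (h : HCpt_hom M N) (g : HCpt_hom L M)
  (f : HCpt_hom K L) : HCpt_comp h (HCpt_comp g f) = HCpt_comp (HCpt_comp h g) f.
Proof.
elim/hclassW: h => h; elim/hclassW: g => g; elim/hclassW: f => f.
by rewrite !HCpt_compE; congr hclass; exact: relmap_eq.
Qed.

Lemma HCpt_comp1f (K L : pcpthaus) (f : HCpt_hom K L) :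
  HCpt_comp (HCpt_id L) f = f.
Proof.
by elim/hclassW: f => f; rewrite HCpt_compE; congr hclass; exact: relmap_eq.
Qed.

Lemma HCpt_compf1 (K L : pcpthaus) (f : HCpt_hom K L) :
  HCpt_comp f (HCpt_id K) = f.
Proof.
by elim/hclassW: f => f; rewrite HCpt_compE; congr hclass; exact: relmap_eq.
Qed.

Definition HCpt : category :=
  Category HCpt_compA HCpt_comp1f HCpt_compf1.

End HCpt.

(* The pointed compact subsets (K, x) of X. *)
Record pcompact (X : topologicalType) (x : X) := Pcompact {
  pcompact_set :> set X;
  pcompact_compact : compact pcompact_set;
  pcompact_base : pcompact_set x }.

Arguments pcompact_compact {X x} p.
Arguments pcompact_base {X x} p.

HB.instance Definition _ (X : topologicalType) (x : X) :=
  gen_eqMixin (pcompact x).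
HB.instance Definition _ (X : topologicalType) (x : X) :=
  gen_choiceMixin (pcompact x).

Fact pcompact_display : Order.disp_t. Proof. exact: Order.Disp tt tt. Qed.

Section pcompact_order.
Context (X : topologicalType) (x : X).

Definition pcompact_le (K L : pcompact x) := `[< K `<=` L >].

Lemma pcompact_le_refl : reflexive pcompact_le.
Proof. by move=> K; apply/asboolP. Qed.

Lemma pcompact_le_trans : transitive pcompact_le.
Proof.
by move=> L K M /asboolP KL /asboolP LM; apply/asboolP; exact: subset_trans LM.
Qed.

HB.instance Definition _ := @Order.Le_isPreorder.Build pcompact_display
  (pcompact x) pcompact_le pcompact_le_refl pcompact_le_trans.

Lemma pcompact_leP (K L : pcompact x) : reflect (K `<=` L) (K <= L)%O.
Proof. exact: asboolP. Qed.

Lemma pcompact_ub (K L : pcompact x) :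
  exists2 M : pcompact x, (K <= M)%O & (L <= M)%O.
Proof.
exists (Pcompact (compactU (pcompact_compact K) (pcompact_compact L))
  (or_introl (pcompact_base K))).
  by apply/pcompact_leP => t; left.
by apply/pcompact_leP => t; right.
Qed.

End pcompact_order.

Section set_type_topology.
Context (X : topologicalType).
Implicit Types K L : set X.

Lemma set_type_compact K : compact K -> compact [set: set_type K].
Proof.
move=> cK F FF _.
pose v : set_type K -> X := val.
have FK : F (v @^-1` K) by apply: filterS filterT => k _; exact: (set_valP k).
have [p [Kp Fp]] := cK (v @ F) (fmap_proper_filter v FF) FK.
exists (Sub p (mem_set Kp)); split=> // A B FA.
rewrite nbhsE => -[W [[V oV VW] Wp] WB].
have [_ [[k Ak <-] Vk]] : v @` A `&` V !=set0.
  apply: Fp; first by apply: (@filterS _ F _ A) => // k Ak; exists k.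
  by apply: open_nbhs_nbhs; split=> //; move: Wp; rewrite -VW.
by exists k; split=> //; apply: WB; rewrite -VW.
Qed.

Lemma set_type_hausdorff K : hausdorff_space X -> hausdorff_space (set_type K).
Proof.
move=> hX p q pq; apply: val_inj; apply: hX => A B nA nB.
have cv : continuous (val : set_type K -> X) by exact: initial_continuous.
have [k [Ak Bk]] := pq _ _ (cv p A nA) (cv q B nB).
by exists (val k).
Qed.

Lemma set_incl_subproof K L (KL : K `<=` L) (k : set_type K) : val k \in L.
Proof. by apply/mem_set/KL; exact: set_valP. Qed.

Definition set_incl K L (KL : K `<=` L) (k : set_type K) : set_type L :=
  Sub (val k) (set_incl_subproof KL k).

Lemma set_incl_continuous K L (KL : K `<=` L) : continuous (set_incl KL).
Proof. by apply: continuous_comp_initial; exact: initial_continuous. Qed.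

End set_type_topology.

Section CH_system.
Context (R : realType) (X : topologicalType) (hX : hausdorff_space X) (x : X).
Implicit Types K L M : pcompact x.

Definition pcompact_space K : pcpthaus :=
  @Pcpthaus (set_type K) (Sub x (mem_set (pcompact_base K)))
    (set_type_compact (pcompact_compact K)) (@set_type_hausdorff X K hX).

Lemma incl_map_sub K L (KL : (K <= L)%O) (k : pcompact_space K) :
  [set pcpthaus_base (pcompact_space K)] k ->
  set_incl (pcompact_leP _ _ KL) k = pcpthaus_base (pcompact_space L).
Proof. by move=> ->; exact: val_inj. Qed.

Definition incl_map K L (KL : (K <= L)%O) :
    ptmap (pcompact_space K) (pcompact_space L) :=
  Relmap (@set_incl_continuous X K L (pcompact_leP _ _ KL))
    (@incl_map_sub K L KL).

Definition CH_map K L (KL : (K <= L)%O) :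
    HCpt_hom R (pcompact_space K) (pcompact_space L) :=
  hclass R (incl_map KL).

Lemma CH_map_id K (KK : (K <= K)%O) :
  CH_map KK = HCpt_id R (pcompact_space K).
Proof. by congr hclass; apply: relmap_eq => k; exact: val_inj. Qed.

Lemma CH_map_comp K L M (KL : (K <= L)%O) (LM : (L <= M)%O) (KM : (K <= M)%O) :
  HCpt_comp (CH_map LM) (CH_map KL) = CH_map KM.
Proof.
by rewrite HCpt_compE; congr hclass; apply: relmap_eq => k; exact: val_inj.
Qed.

Definition CH_system : dirsys (HCpt R) :=
  @Dirsys (HCpt R) pcompact_display (pcompact x) (@pcompact_ub X x)
    pcompact_space CH_map CH_map_id CH_map_comp.

End CH_system.

Definition ShCH_eq (R : realType)
    (X : topologicalType) (hX : hausdorff_space X) (x : X)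
    (Y : topologicalType) (hY : hausdorff_space Y) (y : Y) : Prop :=
  exists (F : dirmor (CH_system R hX x) (CH_system R hY y))
         (G : dirmor (CH_system R hY y) (CH_system R hX x)),
    dirmor_equiv (dirmor_comp G F) (dirmor_id (CH_system R hX x)) /\
    dirmor_equiv (dirmor_comp F G) (dirmor_id (CH_system R hY y)).

(* Main.v *)
Require Import Defs.
From HB Require Import structures.
From mathcomp Require Import all_boot all_order all_algebra.
From mathcomp Require Import all_classical all_reals topology normedtype.

(** The homotopy group of a Hausdorff space is the direct limit of the homotopy
    groups of its compact subsets: a cube, and a cube times the unit interval,
    are compact, so every representing map [I^n -> X] lands in a compact subset
    ([hclass_compact]) and a homotopy which identifies two such maps inside [X]
    already identifies them inside some larger compact subset
    ([iota_eq_compact]).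

    A homotopy class of pointed maps between compact spaces acts on homotopy
    groups by composition, functorially ([hcompA], [hcomp1]) and
    multiplicatively ([hcompM]).  Hence a morphism [F] of the direct systems of
    compact subsets of [X] and [Y] passes to the limit: it induces a
    multiplicative map [phi] characterized by
    [phi (iota K a) = iota (F K) (F_K a)] ([induced_morphism]).  Equivalent
    morphisms of systems agree after enlarging the compact subset, hence induce
    the same map on the limit; therefore the maps induced by the two morphisms
    of a shape equivalence are mutually inverse ([induced_cancel]). *)

Set Implicit Arguments.
Unset Strict Implicit.
Unset Printing Implicit Defensive.

Import Order.TTheory.
Import numFieldNormedType.Exports.
Local Open Scope classical_set_scope.

Lemma unitI_compact (R : realType) : compact [set: unitI R].
Proof. by apply: set_type_compact; exact: segment_compact. Qed.

Lemma cube_compact (R : realType) (n : nat) : compact [set: cube R n].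
Proof.
have := @tychonoff 'I_n (fun=> unitI R) (fun=> setT) (fun=> @unitI_compact R).
by congr compact; apply/seteqP; split.
Qed.

Section composition.
Context (R : realType) (T : topologicalType) (A : set T).

(** The action of a pointed homotopy class on the classes of maps of pairs
    [(T, A) -> (K, base)]; for [(T, A)] the cube and its boundary this is the
    map induced on homotopy groups.  Arbitrary target spaces are allowed so
    that morphisms of compact spaces and inclusions of compact subsets into the
    ambient space are treated alike. *)
Definition hcomp (K : topologicalType) (k : K) (U : topologicalType) (u : U)
    (g : htpy_class R [set k] u) (a : htpy_class R A k) : htpy_class R A u :=
  hclass R (relmap_comp (erefl : [set k] k) (repr g) (repr a)).

Lemma hcompE (K U : topologicalType) (k : K) (u : U)
    (g : relmap [set k] u) (f : relmap A k) :
  hcomp (hclass R g) (hclass R f) =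
  hclass R (relmap_comp (erefl : [set k] k) g f).
Proof. by apply/hclass_eqP/homotopic_comp; exact: homotopic_repr. Qed.

End composition.

Lemma hcompA (R : realType) (T : topologicalType) (A : set T)
    (K L U : topologicalType) (k : K) (l : L) (u : U)
    (h : htpy_class R [set l] u) (g : htpy_class R [set k] l)
    (a : htpy_class R A k) :
  hcomp (hcomp h g) a = hcomp h (hcomp g a).
Proof.
elim/hclassW: h => h; elim/hclassW: g => g; elim/hclassW: a => f.
by rewrite !hcompE; congr hclass; exact: relmap_eq.
Qed.

Lemma hcomp1 (R : realType) (T : topologicalType) (A : set T) (K : pcpthaus)
    (a : htpy_class R A (pcpthaus_base K)) :
  hcomp (HCpt_id R K) a = a.
Proof.
by elim/hclassW: a => f; rewrite hcompE; congr hclass; exact: relmap_eq.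
Qed.

(** Composition on the left leaves the first coordinate of the cube alone, so
    it commutes with concatenation on the nose. *)
Lemma hcompM (R : realType) (n : nat) (K U : topologicalType) (k : K) (u : U)
    (g : htpy_class R [set k] u) (a b : homotopy_group R n.+1 k) :
  hcomp g (hgroup_mul a b) = hgroup_mul (hcomp g a) (hcomp g b).
Proof.
elim/hclassW: g => g; elim/hclassW: a => f; elim/hclassW: b => f'.
rewrite hgroup_mulE !hcompE hgroup_mulE; congr hclass; apply: relmap_eq => t.
by rewrite /= /concat_fun; case: ifP.
Qed.

Section compact_factorization.
Context (R : realType) (X : topologicalType) (hX : hausdorff_space X) (x : X).
Implicit Types K L M : pcompact x.
Local Notation space := (pcompact_space hX).
Local Notation base K := (pcpthaus_base (space K)).

Definition incl_ambient K : relmap [set base K] x :=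
  @Relmap (space K) X [set base K] x val
    (@initial_continuous _ _ (val : set_type K -> X))
    (fun t tb => congr1 val tb).

Context (T : topologicalType) (A : set T).

Definition iota K (a : htpy_class R A (base K)) : htpy_class R A x :=
  hcomp (hclass R (incl_ambient K)) a.

Lemma iota_CH_map K L (KL : (K <= L)%O) (a : htpy_class R A (base K)) :
  iota (hcomp (CH_map R hX KL) a) = iota a.
Proof.
rewrite /iota -hcompA hcompE; congr hcomp; congr hclass.
exact: relmap_eq.
Qed.

Section corestriction.
Context K (S : topologicalType) (f : S -> X)
  (fK : forall s, (K : set X) (f s)).

Definition corestrict (s : S) : space K := Sub (f s) (mem_set (fK s)).

Lemma corestrict_continuous : continuous f -> continuous corestrict.
Proof. by move=> cf; exact: continuous_comp_initial. Qed.

End corestriction.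

(** Any given compact subset can be enlarged to contain the image of a compact
    space; enlarging rather than taking the image alone keeps the result above
    the indices already in play, and keeps the base point inside. *)
Lemma image_bounded (S : topologicalType) (f : S -> X) K :
  compact [set: S] -> continuous f ->
  exists2 M, (K <= M)%O & forall s, (M : set X) (f s).
Proof.
move=> cS cf.
have cfS := continuous_compact (continuous_subspaceT cf) cS.
exists (Pcompact (compactU (pcompact_compact K) cfS)
  (or_introl (pcompact_base K))).
  by apply/pcompact_leP => t; left.
by move=> s; right; exists s.
Qed.

Lemma hclass_compact (c : htpy_class R A x) : compact [set: T] ->
  exists K (a : htpy_class R A (base K)), iota a = c.
Proof.
move=> cT; elim/hclassW: c => f.
pose K0 := Pcompact (@compact_set1 X x) (erefl x).
have [K _ fK] := image_bounded K0 cT (relmap_continuous f).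
have sub t : A t -> corestrict fK t = base K.
  by move=> At; apply: val_inj; exact: relmap_sub.
have cts := @corestrict_continuous K _ _ fK (relmap_continuous f).
exists K, (hclass R (Relmap cts sub)).
by rewrite /iota hcompE; congr hclass; exact: relmap_eq.
Qed.

(** The compact subset obtained here contains the whole track of a homotopy
    between the two images in the ambient space. *)
Lemma iota_eq_compact K L (a : htpy_class R A (base K))
    (b : htpy_class R A (base L)) :
  compact [set: T] -> iota a = iota b ->
  exists M (KM : (K <= M)%O) (LM : (L <= M)%O),
    hcomp (CH_map R hX KM) a = hcomp (CH_map R hX LM) b.
Proof.
move=> cT; elim/hclassW: a => f; elim/hclassW: b => g.
rewrite /iota !hcompE => /hclass_eqP[H [cH H0 H1 HA]].
have [N KN LN] := pcompact_ub K L.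
have cTI : compact [set: T * unitI R].
  by rewrite -setXTT; apply: compact_setX => //; exact: unitI_compact.
have [M NM HM] := image_bounded N cTI cH.
exists M, (le_trans KN NM), (le_trans LN NM).
rewrite !hcompE; apply/hclass_eqP; exists (corestrict HM); split.
- exact: corestrict_continuous.
- by move=> t; apply: val_inj; exact: H0.
- by move=> t; apply: val_inj; exact: H1.
- by move=> t s At; apply: val_inj; exact: HA.
Qed.

End compact_factorization.

Lemma iotaM (R : realType) (n : nat) (X : topologicalType)
    (hX : hausdorff_space X) (x : X) (K : pcompact x)
    (a b : homotopy_group R n.+1 (pcpthaus_base (pcompact_space hX K))) :
  iota (hgroup_mul a b) = hgroup_mul (iota a) (iota b).
Proof. exact: hcompM. Qed.

Section shape_morphisms.
Context (R : realType) (n : nat).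
Context (X : topologicalType) (hX : hausdorff_space X) (x : X).
Context (Y : topologicalType) (hY : hausdorff_space Y) (y : Y).
Local Notation pi X x := (@homotopy_group R n.+1 X x).
Implicit Types K L M : pcompact x.

Context (F : dirmor (CH_system R hX x) (CH_system R hY y)).

Definition level_map K (a : pi (pcompact_space hX K) (pcpthaus_base _)) :
    pi Y y :=
  iota (hcomp (dirmor_ob F K) a).

Lemma level_map_incl K L (KL : (K <= L)%O)
    (a : pi (pcompact_space hX K) (pcpthaus_base _)) :
  level_map (hcomp (CH_map R hX KL) a) = level_map a.
Proof.
rewrite /level_map -[in RHS](iota_CH_map (dirmor_homo F KL)) -!hcompA.
by congr (iota (hcomp _ a)); exact/esym/(dirmor_nat F KL).
Qed.

(** A single compact subset witnesses the equality of the two classes in the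
    ambient space, and there the level maps already agree by naturality. *)
Lemma level_map_eq K L (a : pi (pcompact_space hX K) (pcpthaus_base _))
    (b : pi (pcompact_space hX L) (pcpthaus_base _)) :
  iota a = iota b -> level_map a = level_map b.
Proof.
move=> /(iota_eq_compact (@cube_compact R n.+1))[M [KM [LM ab]]].
by rewrite -(level_map_incl KM) ab level_map_incl.
Qed.

(** The level maps are compatible with inclusions, so they define a map on the
    direct limit; multiplicativity holds because any two classes of [X] come
    from one common compact subset. *)
Lemma induced_morphism : exists phi : pi X x -> pi Y y,
  {morph phi : a b / hgroup_mul a b} /\
  forall K (a : pi (pcompact_space hX K) (pcpthaus_base _)),
    phi (iota a) = level_map a.
Proof.
have ex (c : pi X x) : exists d, forall K
    (a : pi (pcompact_space hX K) (pcpthaus_base _)),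
    iota a = c -> level_map a = d.
  have [K [a <-]] := hclass_compact hX c (@cube_compact R n.+1).
  by exists (level_map a) => L b; exact: level_map_eq.
have [phi phiE] := choice ex.
have phi_iota K (a : pi (pcompact_space hX K) (pcpthaus_base _)) :
  phi (iota a) = level_map a by exact/esym/phiE.
exists phi; split=> // c d.
have [K [a <-]] := hclass_compact hX c (@cube_compact R n.+1).
have [L [b <-]] := hclass_compact hX d (@cube_compact R n.+1).
have [M KM LM] := pcompact_ub K L.
rewrite -(iota_CH_map KM a) -(iota_CH_map LM b) -iotaM !phi_iota.
by rewrite /level_map hcompM; exact: iotaM.
Qed.

End shape_morphisms.

(** On a class coming from [K], the composite is the action of [G F] at level
    [K]; after enlargement to some compact [M], the equivalence of [G F] with
    the identity turns this action into that of the inclusion [K -> M], which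
    is invisible in the limit. *)
Lemma induced_cancel (R : realType) (n : nat)
    (X : topologicalType) (hX : hausdorff_space X) (x : X)
    (Y : topologicalType) (hY : hausdorff_space Y) (y : Y)
    (F : dirmor (CH_system R hX x) (CH_system R hY y))
    (G : dirmor (CH_system R hY y) (CH_system R hX x))
    (phi : homotopy_group R n.+1 x -> homotopy_group R n.+1 y)
    (psi : homotopy_group R n.+1 y -> homotopy_group R n.+1 x) :
  dirmor_equiv (dirmor_comp G F) (dirmor_id (CH_system R hX x)) ->
  (forall K (a : homotopy_group R n.+1 (pcpthaus_base (pcompact_space hX K))),
    phi (iota a) = level_map F a) ->
  (forall L (b : homotopy_group R n.+1 (pcpthaus_base (pcompact_space hY L))),
    psi (iota b) = level_map G b) ->
  cancel phi psi.
Proof.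
move=> GF phiE psiE c.
have [K [a <-]] := hclass_compact hX c (@cube_compact R n.+1).
have [M [GFM [KM e]]] := GF K.
rewrite phiE psiE /level_map -hcompA -(iota_CH_map GFM) -hcompA.
transitivity (iota (hcomp (CH_map R hX KM) a)); last exact: iota_CH_map.
by congr (iota (hcomp _ a)); rewrite [LHS]e [LHS]cat_compf1.
Qed.

Theorem theorem4p8 (R : realType)
    (X : topologicalType) (hX : hausdorff_space X) (x : X)
    (Y : topologicalType) (hY : hausdorff_space Y) (y : Y) :
  ShCH_eq R hX x hY y ->
  forall n : nat,
    isomorphic_groups (homotopy_group R n.+1 x) (homotopy_group R n.+1 y).
Proof.
move=> [F [G [GF FG]]] n.
have [phi [phiM phiE]] := induced_morphism n F.
have [psi [_ psiE]] := induced_morphism n G.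
pose phi_multiplicative := isMultiplicative.Build _ _ phi phiM.
pose phi_morphism : {multiplicative homotopy_group R n.+1 x ->
  homotopy_group R n.+1 y} := HB.pack phi phi_multiplicative.
exists phi_morphism; exists psi.
- exact: induced_cancel GF phiE psiE.
- exact: induced_cancel FG psiE phiE.
Qed.
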